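(* Let $d$ be a positive integer that is not a perfect square. Then for every integer $z$ we have $$\sqrt{d}=\left[\,z,\overline{\frac{2z}{d-z^2},\,2z}\,\right],$$ and the convergents of this periodic continued fraction are the Rédei rational functions $Q_n(d,z)$, $n\ge 1$ (that is, the convergent of index $m$, with indices starting at $m=0$, is $Q_{m+1}(d,z)$ for every $m\ge 0$).
   Context: Continued fractions here may have rational partial quotients: $[c_0,c_1,c_2,\ldots]$ denotes $c_0+\cfrac{1}{c_1+\cfrac{1}{c_2+\cdots}}$, its convergent of index $m\ge 0$ is the finite continued fraction $[c_0,\ldots,c_m]$, and $\alpha=[c_0,c_1,c_2,\ldots]$ means that the convergents tend to $\alpha$ in $\mathbb R$. An overline denotes a block repeated periodically, so $\left[z,\overline{\frac{2z}{d-z^2},2z}\right]$ has partial quotients $c_0=z$, $c_{2k-1}=\frac{2z}{d-z^2}$ and $c_{2k}=2z$ for $k\ge1$. For $d$ a positive nonsquare integer and $z$ an integer, the integers $N_n(d,z)$, $D_n(d,z)$ are defined by $(z+\sqrt d)^n=N_n(d,z)+D_n(d,z)\sqrt d$, i.e. $N_n(d,z)=\sum_{i\ge 0}\binom{n}{2i}d^iz^{n-2i}$ and $D_n(d,z)=\sum_{i\ge 0}\binom{n}{2i+1}d^iz^{n-2i-1}$ (terms with zero binomial coefficient are omitted). The Rédei rational functions are $Q_n(d,z)=N_n(d,z)/D_n(d,z)$ for $n\ge1$.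
   Formalization: The equality √d = [z, …] is asserted only for z > 0: for z < 0 the convergents tend to −√d (e.g. d = 2, z = −1), and for z = 0 they are undefined. The convergents are identified with Q_{m+1}(d,z) for every z, at z = 0 only under the convention x/0 = 0. *)

(* Defs.v *)
From HB Require Import structures.
From mathcomp Require Import all_boot all_order all_algebra.
From mathcomp Require Import all_classical all_reals all_analysis.

Set Implicit Arguments.
Unset Strict Implicit.
Unset Printing Implicit Defensive.

Import Order.TTheory GRing.Theory Num.Theory.
Import numFieldNormedType.Exports.

Local Open Scope classical_set_scope.
Local Open Scope ring_scope.

Fixpoint cfrac (s : seq rat) : rat :=
  match s with
  | [::] => 0
  | [:: c] => c
  | c :: s' => c + (cfrac s')^-1
  end.

(* Inversion on [rat] is total with 0^-1 = 0, so [cfrac s] is the genuine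
   finite continued fraction only when no inverted tail vanishes. *)
Fixpoint cfrac_defined (s : seq rat) : bool :=
  match s with
  | [::] => false
  | [:: _] => true
  | _ :: s' => cfrac_defined s' && (cfrac s' != 0)
  end.

Definition convergent (c : nat -> rat) (m : nat) : rat := cfrac (mkseq c m.+1).

Definition convergent_defined (c : nat -> rat) (m : nat) : bool :=
  cfrac_defined (mkseq c m.+1).

(* alpha = [c 0, c 1, ...] *)
Definition is_cfrac (R : realType) (alpha : R) (c : nat -> rat) : Prop :=
  (forall m, convergent_defined c m) /\
  (fun m => ratr (convergent c m) : R) @ \oo --> alpha.

Definition sqrt_cf (d : nat) (z : int) (k : nat) : rat :=
  if k == 0%N then z%:Q
  else if odd k then (2 * z%:Q) / (d%:R - z%:Q ^+ 2)
  else 2 * z%:Q.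

(* (z + sqrt d)^n = redeiN n d z + redeiD n d z * sqrt d *)
Definition redeiN (n d : nat) (z : int) : int :=
  \sum_(i < n.+1 | (2 * i <= n)%N)
    ('C(n, 2 * i))%:Z * d%:Z ^+ i * z ^+ (n - 2 * i).

Definition redeiD (n d : nat) (z : int) : int :=
  \sum_(i < n.+1 | (2 * i + 1 <= n)%N)
    ('C(n, 2 * i + 1))%:Z * d%:Z ^+ i * z ^+ (n - 2 * i - 1).

Definition redeiQ (n d : nat) (z : int) : rat :=
  (redeiN n d z)%:Q / (redeiD n d z)%:Q.

(* Main.v *)
(** Put w = d - z^2.  Expanding (z + s)^n with s^2 = d gives
    N_{n+1} = z N_n + d D_n and D_{n+1} = N_n + z D_n, hence
    D_{n+2} = 2 z D_{n+1} + w D_n.  By this recurrence the tail of n partial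
    quotients is D_{n+1} / (w D_n) when it starts at an odd index and
    D_{n+1} / D_n when it starts at a positive even one, so the convergent of
    index m is z + w D_m / D_{m+1} = N_{m+1} / D_{m+1}.  With
    r = (z - sqrt d) / (z + sqrt d), this is
    sqrt d (1 + r^{m+1}) / (1 - r^{m+1}), and |r| < 1 for z > 0. *)

Require Import Defs.
From mathcomp Require Import all_boot all_order all_algebra all_field.
From mathcomp Require Import all_classical all_reals all_analysis.
From mathcomp Require Import ring lra zify.

Import Order.TTheory GRing.Theory Num.Theory.
Import numFieldNormedType.Exports.

Local Open Scope ring_scope.

(** * Rédei numbers: binomial expansion, recurrences and signs *)

Lemma big_ord_double (V : zmodType) (F : nat -> V) (m : nat) :
  \sum_(i < 2 * m) F i = \sum_(i < m) F (2 * i)%N + \sum_(i < m) F (2 * i + 1)%N.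
Proof.
elim: m => [|m IHm]; first by rewrite muln0 !big_ord0 addr0.
have -> : (2 * m.+1)%N = (2 * m).+2 by lia.
by rewrite !big_ord_recr /= IHm addn1 -addrA addrACA.
Qed.

(** An arbitrary ring and square root [s] are allowed, so that both [s] and [- s] can be used, in
    [algC] for the recurrences and in the reals for the limit. *)
Lemma redei_exp (A : comNzRingType) (d : nat) (z : int) (s : A) (n : nat) :
  s ^+ 2 = d%:R ->
  (z%:~R + s) ^+ n = (redeiN n d z)%:~R + (redeiD n d z)%:~R * s.
Proof.
move=> sq_s; pose F i : A := z%:~R ^+ (n - i) * s ^+ i *+ 'C(n, i).
rewrite exprDn -/(F _).
(* The added terms have zero binomials; now the even and odd halves range over i < n+1, as in
   [redeiN] and [redeiD]. *)
have -> : \sum_(i < n.+1) F i = \sum_(i < 2 * n.+1) F i.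
  rewrite -!(big_mkord predT F) [RHS](big_cat_nat (leq0n n.+1)) /=; last by lia.
  rewrite [X in _ + X]big_nat [X in _ + X]big1 ?addr0 // => i /andP[lt_ni _].
  by rewrite /F bin_small.
have F0 i : (n < i)%N -> F i = 0 by move=> lt_ni; rewrite /F bin_small.
rewrite big_ord_double; congr (_ + _).
  rewrite /redeiN raddf_sum [RHS]big_mkcond; apply: eq_bigr => i _ /=.
  case: leqP => [le_in|]; last exact: F0.
  rewrite !rmorphM !rmorphXn /= -!pmulrn /F exprM sq_s -mulr_natl; ring.
rewrite /redeiD raddf_sum big_distrl [RHS]big_mkcond.
apply: eq_bigr => i _ /=.
case: leqP => [le_in|]; last exact: F0.
rewrite !rmorphM !rmorphXn /= -!pmulrn /F exprD exprM sq_s -mulr_natl subnDA.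
ring.
Qed.

(** Adding and subtracting the expansions at s and -s isolates N and D, so irrationality of s is not
    involved. *)
Lemma redeiS (n d : nat) (z : int) : (0 < d)%N ->
  redeiN n.+1 d z = z * redeiN n d z + d%:Z * redeiD n d z /\
  redeiD n.+1 d z = redeiN n d z + z * redeiD n d z.
Proof.
move=> d_gt0; pose s : algC := sqrtC d%:R.
have sq_s : s ^+ 2 = d%:R by rewrite sqrtCK.
have s_neq0 : s != 0 by rewrite sqrtC_eq0 pnatr_eq0 -lt0n.
have sq_Ns : (- s) ^+ 2 = d%:R by rewrite sqrrN.
have := redei_exp _ d z (- s) n.+1 sq_Ns; have := redei_exp _ d z s n.+1 sq_s.
rewrite !exprS (redei_exp _ d z s n sq_s) (redei_exp _ d z (- s) n sq_Ns) => eD eB.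
have two_neq0 : (2 : algC) != 0 by rewrite pnatr_eq0.
split; apply: (@intr_inj algC); rewrite rmorphD /= !rmorphM /= -?pmulrn -?sq_s.
  apply: (mulfI two_neq0).
  transitivity ((z%:~R + s) * ((redeiN n d z)%:~R + (redeiD n d z)%:~R * s)
    + (z%:~R - s) * ((redeiN n d z)%:~R + (redeiD n d z)%:~R * - s)).
    by rewrite eD eB; ring.
  ring.
(* The difference carries the factor 2s, nonzero because d > 0. *)
apply: (mulfI (mulf_neq0 two_neq0 s_neq0)).
transitivity ((z%:~R + s) * ((redeiN n d z)%:~R + (redeiD n d z)%:~R * s)
  - (z%:~R - s) * ((redeiN n d z)%:~R + (redeiD n d z)%:~R * - s)).
  by rewrite eD eB; ring.
ring.
Qed.

Lemma redeiN0 (d : nat) (z : int) : redeiN 0 d z = 1.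
Proof. by rewrite /redeiN big_mkcond big_ord1 /= bin0 !mulr1. Qed.

Lemma redeiD0 (d : nat) (z : int) : redeiD 0 d z = 0.
Proof. by rewrite /redeiD big_mkcond big_ord1. Qed.

(* N_n and D_n may be negative for negative z; the powers of z undo this. *)
Lemma redei_ge0 (n d : nat) (z : int) : (0 < d)%N -> z != 0 ->
  0 < redeiN n d z * z ^+ n /\ 0 <= redeiD n d z * z ^+ n.+1.
Proof.
move=> d_gt0 z_neq0; have zz : 0 < z ^+ 2 by rewrite exprn_even_gt0.
elim: n => [|n [IHN IHD]]; first by rewrite redeiN0 redeiD0 mul0r mulr1.
have [-> ->] := redeiS n d z d_gt0; split.
  have -> : (z * redeiN n d z + d%:Z * redeiD n d z) * z ^+ n.+1 =
    z ^+ 2 * (redeiN n d z * z ^+ n) + d%:Z * (redeiD n d z * z ^+ n.+1).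
    by rewrite exprS; ring.
  by apply: ltr_wpDr; [exact: mulr_ge0|exact: mulr_gt0].
have -> : (redeiN n d z + z * redeiD n d z) * z ^+ n.+2 =
  z ^+ 2 * (redeiN n d z * z ^+ n) + z ^+ 2 * (redeiD n d z * z ^+ n.+1).
  by rewrite !exprS; ring.
by apply: addr_ge0; apply: mulr_ge0 => //; exact: ltW.
Qed.

Lemma redeiD_neq0 (n d : nat) (z : int) : (0 < d)%N -> z != 0 ->
  redeiD n.+1 d z != 0.
Proof.
move=> d_gt0 z_neq0; have [N_gt0 D_ge0] := redei_ge0 n d z d_gt0 z_neq0.
have [_ ->] := redeiS n d z d_gt0.
suff: 0 < (redeiN n d z + z * redeiD n d z) * z ^+ n.
  by apply: contraTneq => ->; rewrite mul0r ltxx.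
have -> : (redeiN n d z + z * redeiD n d z) * z ^+ n =
  redeiN n d z * z ^+ n + redeiD n d z * z ^+ n.+1 by rewrite exprS; ring.
exact: ltr_wpDr.
Qed.

Lemma redeiQ_z0 (n d : nat) : (0 < d)%N -> redeiQ n d 0 = 0.
Proof.
move=> d_gt0; have ND0 : redeiN n d 0 * redeiD n d 0 = 0.
  (* At z = 0 the recurrences swap N and D up to the factor d, so one of them always vanishes; if it
     is D, the quotient is 0 by convention. *)
  elim: n => [|n IHn]; first by rewrite redeiD0 mulr0.
  have [-> ->] := redeiS n d 0 d_gt0.
  by rewrite !mul0r add0r addr0 -mulrA [_ * redeiN _ _ _]mulrC IHn mulr0.
apply/eqP; rewrite /redeiQ mulf_eq0 invr_eq0 !intr_eq0.
by rewrite -mulf_eq0 ND0.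
Qed.

(** * Convergence to the square root *)

Lemma redeiQ_cvg (R : realType) (d : nat) (z : int) : (0 < d)%N -> 0 < z ->
  ((fun m => ratr (redeiQ m.+1 d z) : R) @ \oo --> (Num.sqrt d%:R : R))%classic.
Proof.
move=> d_gt0 z_gt0; set s : R := Num.sqrt _.
have sq_s : s ^+ 2 = d%:R by rewrite sqr_sqrtr.
have s_gt0 : 0 < s by rewrite sqrtr_gt0 ltr0n.
have zR : 0 < z%:~R :> R by rewrite ltr0z.
set x : R := z%:~R in zR *.
pose r := (x - s) / (x + s).
have xs_gt0 : 0 < x + s by lra.
have r_lt1 : `|r| < 1.
  rewrite /r normrM normfV (gtr0_norm xs_gt0) ltr_pdivrMr // mul1r.
  by rewrite ltr_norml; lra.
have eQ m : ratr (redeiQ m.+1 d z) = s * (1 + r ^+ m.+1) / (1 - r ^+ m.+1) :> R.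
  have rn_lt1 : `|r ^+ m.+1| < 1 by rewrite normrX exprn_ilt1.
  have rn_neq1 : 1 - r ^+ m.+1 != 0.
    by move: rn_lt1; rewrite ltr_norml => /andP[_ ?]; apply: lt0r_neq0; lra.
  have xsn : (x + s) ^+ m.+1 != 0 by rewrite expf_neq0 // lt0r_neq0.
  have rE : r ^+ m.+1 = (x - s) ^+ m.+1 / (x + s) ^+ m.+1.
    by rewrite /r expr_div_n.
  have eD := redei_exp _ d z s m.+1 sq_s.
  have eB : (x - s) ^+ m.+1 = (redeiN m.+1 d z)%:~R - (redeiD m.+1 d z)%:~R * s.
    by rewrite -mulrN; apply: redei_exp; rewrite sqrrN.
  rewrite -/x in eD.
  rewrite /redeiQ fmorph_div /= !ratr_int.
  rewrite rE in rn_neq1 *; rewrite eB eD in xsn rn_neq1 *.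
  move: (redeiN _ _ _)%:~R (redeiD _ _ _)%:~R xsn rn_neq1 => N D xsn rn_neq1.
  (* D = 0 would force r^(m+1) = 1. *)
  have D_neq0 : D != 0.
    apply: contraNneq rn_neq1 => D0; apply/eqP.
    rewrite D0 mul0r subr0 addr0 in xsn *.
    by rewrite divff // subrr.
  field.
  rewrite D_neq0 xsn /=.
  have -> : N + D * s - (N - D * s) = 2 * D * s by ring.
  by rewrite !mulf_neq0 ?pnatr_eq0 // lt0r_neq0.
rewrite (_ : (fun m => _) = fun m => s * (1 + r ^+ m.+1) / (1 - r ^+ m.+1)); last first.
  by apply/funext => m; exact: eQ.
have r_cvg : ((fun m => r ^+ m.+1) @ \oo --> (0 : R))%classic.
  by rewrite (cvg_shiftS (fun m => r ^+ m)); exact: cvg_expr.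
have {2}<- : s * (1 + 0) / (1 - 0) = s.
  by rewrite addr0 subr0 mulr1 divr1.
apply: cvgM.
  by apply: cvgMr; apply: cvgD => //; exact: cvg_cst.
by apply: cvgV; [rewrite subr0 oner_neq0|apply: cvgB => //; exact: cvg_cst].
Qed.

(** * Convergents of the periodic continued fraction *)

Lemma cfrac_cons (c : rat) (s : seq rat) : cfrac (c :: s) = c + (cfrac s)^-1.
(* The empty tail is covered too, since 0^-1 = 0. *)
Proof. by case: s => //=; rewrite invr0 addr0. Qed.

Lemma mkseqS (T : Type) (f : nat -> T) (n : nat) :
  mkseq f n.+1 = f 0%N :: mkseq (fun i => f i.+1) n.
Proof. by rewrite /mkseq /= -[1%N]/(1 + 0)%N iotaDl -map_comp. Qed.

Lemma cfrac_mkseq0 (c : nat -> rat) (n : nat) :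
  (forall i, c i = 0) -> cfrac (mkseq c n) = 0.
Proof.
elim: n c => // n IHn c c0.
by rewrite mkseqS cfrac_cons IHn ?c0 // invr0 addr0.
Qed.

Section SqrtCf.
Variables (d : nat) (z : int).
Hypotheses (d_gt0 : (0 < d)%N) (d_nonsquare : ~ (exists k : nat, d = (k ^ 2)%N)).
Hypothesis z_neq0 : z != 0.

Let w : rat := d%:R - z%:Q ^+ 2.
Let D n : rat := (redeiD n d z)%:~R.

(** Nonsquareness of [d] makes the partial quotients 2z/(d - z^2) genuine. *)
Let w_neq0 : w != 0.
Proof.
apply/eqP => /eqP; rewrite subr_eq0 => /eqP dz; apply: d_nonsquare.
exists `|z|%N; apply/eqP; rewrite -(eqr_nat rat) dz natrX.
by rewrite natr_absz intr_norm -normrX ger0_norm // sqr_ge0.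
Qed.

Let D_neq0 n : D n.+1 != 0.
Proof. by rewrite intr_eq0 redeiD_neq0. Qed.

Let D_SS n : D n.+2 = 2 * z%:Q * D n.+1 + w * D n.
Proof.
rewrite /D /w; have [_ ->] := redeiS n.+1 d z d_gt0.
have [-> ->] := redeiS n d z d_gt0.
by rewrite !(rmorphD, rmorphM) /= -!pmulrn; ring.
Qed.

(** The starting index [k] stays free because each step of an induction on the length flips its
    parity. *)
Definition sqrt_cf_tail k n := mkseq (fun i => sqrt_cf d z (k + i)) n.

Lemma sqrt_cf_tailS k n :
  sqrt_cf_tail k n.+1 = sqrt_cf d z k :: sqrt_cf_tail k.+1 n.
Proof.
rewrite /sqrt_cf_tail mkseqS addn0; congr cons.
by apply: eq_mkseq => i; rewrite addnS.
Qed.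

(* For n = 0 both sides are 0, since cfrac [::] = 0, D 0 = 0 and 0^-1 = 0. *)
Lemma cfrac_sqrt_cf_tail k n :
  cfrac (sqrt_cf_tail k.+1 n) = if odd k.+1 then D n.+1 / (w * D n) else D n.+1 / D n.
Proof.
elim: n k => [|n IHn] k.
  have -> : D 0 = 0 by rewrite /D redeiD0.
  by rewrite mulr0 invr0 mulr0 if_same.
rewrite sqrt_cf_tailS cfrac_cons IHn /sqrt_cf -/w D_SS /= negbK.
have := D_neq0 n => Dn.
(* Inversion puts [D n] in a numerator, so [D 0] = 0 is harmless. *)
by case: (odd k) => /=; rewrite invf_div; field; rewrite ?w_neq0 Dn.
Qed.

Lemma sqrt_cf_tail_neq0 k n : cfrac (sqrt_cf_tail k.+1 n.+1) != 0.
Proof.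
rewrite cfrac_sqrt_cf_tail.
by case: ifP => _; rewrite !mulf_neq0 ?invr_neq0 ?mulf_neq0.
Qed.

Lemma sqrt_cf_tail_defined k n : cfrac_defined (sqrt_cf_tail k n.+1).
Proof.
elim: n k => // n IHn k; rewrite sqrt_cf_tailS.
have := IHn k.+1; have := sqrt_cf_tail_neq0 k n.
by rewrite sqrt_cf_tailS /= => -> ->.
Qed.

Lemma convergent_sqrt_cf_defined m : convergent_defined (sqrt_cf d z) m.
Proof. exact: (sqrt_cf_tail_defined 0). Qed.

Lemma convergent_sqrt_cf m : convergent (sqrt_cf d z) m = redeiQ m.+1 d z.
Proof.
rewrite /convergent -/(sqrt_cf_tail 0 m.+1) sqrt_cf_tailS cfrac_cons.
rewrite cfrac_sqrt_cf_tail /= invf_div /redeiQ -/(D m.+1) /sqrt_cf /=.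
(* Eliminate N_m between the two recurrences. *)
have -> : (redeiN m.+1 d z)%:Q = z%:Q * D m.+1 + w * D m.
  rewrite /D /w; have [-> ->] := redeiS m d z d_gt0.
  by rewrite !(rmorphD, rmorphM) /= -!pmulrn; ring.
by field; exact: D_neq0.
Qed.

End SqrtCf.

(** The limit is claimed for z > 0: if z < 0 then |r| > 1 and the convergents tend to -sqrt d. If z
    = 0 all partial quotients vanish, and the equality of convergents holds through 0^-1 = 0. *)
Theorem theorem1 (R : realType) (d : nat) (d_gt0 : (0 < d)%N)
    (d_nonsquare : ~ (exists k : nat, d = (k ^ 2)%N)) (z : int) :
  (0 < z -> is_cfrac (Num.sqrt (d%:R : R)) (sqrt_cf d z)) /\
  (forall m : nat,
     convergent (sqrt_cf d z) m = redeiQ m.+1 d z /\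
     (z <> 0 -> convergent_defined (sqrt_cf d z) m /\ redeiD m.+1 d z <> 0)).
Proof.
have convE m : convergent (sqrt_cf d z) m = redeiQ m.+1 d z.
  have [->|z_neq0] := eqVneq z 0; last exact: convergent_sqrt_cf.
  rewrite redeiQ_z0 //; apply: cfrac_mkseq0 => k.
  by rewrite /sqrt_cf; case: eqP => // _; case: odd; rewrite mulr0 ?mul0r.
split=> [z_gt0|m].
  split=> [m|].
    by apply: convergent_sqrt_cf_defined => //; rewrite gt_eqF.
  under eq_fun do rewrite convE.
  exact: redeiQ_cvg.
split=> // /eqP z_neq0; split; first exact: convergent_sqrt_cf_defined.
by apply/eqP; exact: redeiD_neq0.
Qed.
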